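(* Let $k\ge 1$ and let $v_1,\dots,v_k,v_{k+1}\in\mathcal{H}$. Put $\mathcal{V}_k=\operatorname{span}\{v_i\}_{i=1}^{k}$, assume $\mathcal{V}_k\cap\mathcal{W}^\perp=\{0\}$ and $v_{k+1}\in\mathcal{V}_k$ (so $\mathcal{V}_{k+1}:=\operatorname{span}\{v_i\}_{i=1}^{k+1}=\mathcal{V}_k$), and let $u_{k+1}=v_{k+1}-\hat P_{\mathcal{W}^\perp}v_{k+1}$. Let $\tilde u_1^k,\dots,\tilde u_k^k\in\mathcal{H}$ be vectors such that $\hat E_{\mathcal{V}_k\mathcal{W}^\perp}=\sum_{i=1}^k v_i\langle\tilde u_i^k,\cdot\rangle$. For an arbitrary vector $y_{k+1}\in\mathcal{H}$ define $$\tilde u_i^{k+1}=\tilde u_i^k-\langle u_{k+1},\tilde u_i^k\rangle\,y_{k+1},\quad i=1,\dots,k,\qquad \tilde u_{k+1}^{k+1}=y_{k+1}.$$ Then these vectors produce the same oblique projector: $$\sum_{i=1}^{k+1}v_i\langle\tilde u_i^{k+1},\cdot\rangle=\hat E_{\mathcal{V}_k\mathcal{W}^\perp}.$$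
   Context: $\mathcal{H}$ is a complex inner product space; $\langle\cdot,\cdot\rangle$ is conjugate-linear in the first argument and linear in the second, and $v\langle u,\cdot\rangle$ denotes the operator $f\mapsto\langle u,f\rangle v$. $\mathcal{W}^\perp\subset\mathcal{H}$ is a fixed closed subspace (the symbol is just its name) for which the orthogonal projector $\hat P_{\mathcal{W}^\perp}$ of $\mathcal{H}$ onto it exists. For a finite-dimensional subspace $\mathcal{X}\subset\mathcal{H}$ with $\mathcal{X}\cap\mathcal{W}^\perp=\{0\}$, the oblique projector $\hat E_{\mathcal{X}\mathcal{W}^\perp}$ onto $\mathcal{X}$ along $\mathcal{W}^\perp$ is the linear operator on $\mathcal{H}$ with $\hat E_{\mathcal{X}\mathcal{W}^\perp}x=x$ for $x\in\mathcal{X}$, $\hat E_{\mathcal{X}\mathcal{W}^\perp}w=0$ for $w\in\mathcal{W}^\perp$, and $\hat E_{\mathcal{X}\mathcal{W}^\perp}f=0$ for $f$ orthogonal to $\mathcal{X}+\mathcal{W}^\perp$. (If $\mathcal{X}=\operatorname{span}\{v_i\}_{i=1}^k$ and $\hat V:\mathbb{C}^k\to\mathcal{H}$ sends the $i$-th standard basis vector to $v_i$, this is $\hat V(\hat V^*\hat P\hat V)^\dagger\hat V^*\hat P$, where $\hat P$ is the orthogonal projector onto the orthogonal complement of $\mathcal{W}^\perp$ in $\mathcal{X}+\mathcal{W}^\perp$ and $\dagger$ is the Moore-Penrose pseudo-inverse.) *)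

(* Defs.v *)
From HB Require Import structures.
From mathcomp Require Import all_boot all_order all_algebra.
From mathcomp Require Import all_classical all_reals all_analysis.
From mathcomp Require Export complex.

Set Implicit Arguments.
Unset Strict Implicit.
Unset Printing Implicit Defensive.

Import Order.TTheory GRing.Theory Num.Theory numFieldNormedType.Exports.

Local Open Scope classical_set_scope.
Local Open Scope ring_scope.

(* A complex inner product space is a normed module H over R[i] together with
   a form ip satisfying [norm_of_form ip]; the topology of H, hence [closed],
   is then the one induced by the inner product. *)
Definition norm_of_form (R : realType) (H : normedModType R[i])
    (ip : {dot H for Num.conj}) : Prop :=
  forall x : H, `|x| = sqrtC (ip x x).

(* Forms of type {dot _ for _} are linear in their first argument, whereas
   <u, f> is conjugate-linear in u and linear in f: hence the swap. *)
Definition inner (R : realType) (H : lmodType R[i])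
    (ip : {dot H for Num.conj}) (u f : H) : R[i] := ip f u.

Definition span_of (K : pzRingType) (H : lmodType K) (n : nat)
    (v : 'I_n -> H) : set H :=
  [set x | exists c : 'I_n -> K, x = \sum_(i < n) c i *: v i].

Definition set_sum (V : nmodType) (A B : set V) : set V :=
  [set a + b | a in A & b in B].

Definition orthogonal_to (R : realType) (H : lmodType R[i])
    (ip : {dot H for Num.conj}) (A : set H) (f : H) : Prop :=
  forall a, A a -> inner ip a f = 0.

Definition is_orthogonal_projector (R : realType) (H : lmodType R[i])
    (ip : {dot H for Num.conj}) (W : set H) (P : {linear H -> H}) : Prop :=
  forall f, W (P f) /\ orthogonal_to ip W (f - P f).

Definition is_oblique_projector (R : realType) (H : lmodType R[i])
    (ip : {dot H for Num.conj}) (X W : set H) (E : {linear H -> H}) : Prop :=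
  [/\ forall x, X x -> E x = x,
      forall w, W w -> E w = 0 &
      forall f, orthogonal_to ip (set_sum X W) f -> E f = 0].

(* Main.v *)
(* Since [P] has range in [W], on which [E] vanishes, [E u = v_(k+1)]: the
   correction [- <y, f> E u] coming from the first [k] terms cancels the extra
   term [<y, f> v_(k+1)]. *)
Require Import Defs.
From HB Require Import structures.
From mathcomp Require Import all_boot all_order all_algebra.
From mathcomp Require Import all_classical all_reals all_analysis.

Set Implicit Arguments.
Unset Strict Implicit.
Unset Printing Implicit Defensive.

Import Order.TTheory GRing.Theory Num.Theory numFieldNormedType.Exports.

Local Open Scope classical_set_scope.
Local Open Scope ring_scope.

(** Expanding the new sum by conjugate-linearity gives [E f - <y, f> E u + <y, f> v_(k+1)]. Since
    [u] and [v_(k+1)] differ by an element of [W] and [v_(k+1)] lies in the range of [E], the last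
    two terms cancel for every [y]. *)

Theorem proposition1 (R : realType) (H : normedModType R[i])
  (ip : {dot H for Num.conj}) (Hip : norm_of_form ip)
  (W : set H) (W_submod : GRing.submod_closed [in W]) (W_closed : closed W)
  (P : {linear H -> H}) (HP : is_orthogonal_projector ip W P)
  (k : nat) (k_ge1 : (1 <= k)%N)
  (v : 'I_k.+1 -> H) (vk : 'I_k -> H)
  (Hvk : forall i : 'I_k, vk i = v (widen_ord (leqnSn k) i))
  (VkW : span_of vk `&` W = [set 0])
  (vk1_in : span_of vk (v ord_max))
  (u : H) (Hu : u = v ord_max - P (v ord_max))
  (E : {linear H -> H}) (HE : is_oblique_projector ip (span_of vk) W E)
  (ut : 'I_k -> H)
  (Hut : forall f : H, E f = \sum_(i < k) inner ip (ut i) f *: vk i)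
  (y : H) (ut' : 'I_k.+1 -> H)
  (Hut' : forall i : 'I_k,
    ut' (widen_ord (leqnSn k) i) = ut i - inner ip u (ut i) *: y)
  (Hut'_max : ut' ord_max = y) :
  forall f : H, \sum_(i < k.+1) inner ip (ut' i) f *: v i = E f.
Proof.
have Ev : E u = v ord_max.
  have [EV EW _] := HE; have [PW _] := HP (v ord_max).
  by rewrite Hu linearB /= EV // EW // subr0.
move=> f; rewrite big_ord_recr /= Hut'_max.
under eq_bigr => i _.
  rewrite Hut' -Hvk /inner linearBr linearZr /= scalerBl.
  (* The coefficient [<u, ut i>] leaves the conjugate-linear slot conjugated; by Hermitian symmetry
     it becomes [<ut i, u>], the coefficient of [vk i] in [E u]. *)
  have -> : Num.conj (ip (ut i) u) = ip u (ut i) by rewrite [RHS]hermC /= expr0 mul1r.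
  rewrite mulrC -scalerA.
  over.
rewrite sumrB -scaler_sumr -/(inner ip y f).
(* [Hut] is folded twice: at [u] for the sum scaled by [<y, f>], then at [f] for the remaining
   one. *)
by rewrite -[X in _ *: X]Hut Ev -Hut subrK.
Qed.
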